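(* Let $X$ be a birth-and-death chain with state space $\mathcal{X}=\{0,1,\ldots,n\}$ and symmetric kernel, and let $U$ be the uniform chain. Suppose that both chains start at $0$, and let $\pi_t$ (resp., $\sigma_t$) denote the probability mass function of $X_t$ (resp., $U_t$). Then $\pi_t$ majorizes $\sigma_t$ for all $t=0,1,2,\ldots$.
   Context: Chains are discrete-time and time-homogeneous; $n$ is a positive integer. A birth-and-death chain on $\{0,\ldots,n\}$ is a Markov chain whose kernel $K$ satisfies $K(i,j)=0$ whenever $|i-j|>1$ (arbitrary holding probabilities $K(i,i)$ are allowed). The kernel is symmetric if $K(i,j)=K(j,i)$ for all $i,j$. The uniform chain $U$ is the birth-and-death chain on $\{0,\ldots,n\}$ with transition probability $1/2$ in each direction along each edge, i.e. $K_0(i,i+1)=K_0(i+1,i)=1/2$ for $0\le i\le n-1$, with $K_0(0,0)=K_0(n,n)=1/2$ and $K_0(i,i)=0$ for $0<i<n$. For vectors $v,w\in\mathbf{R}^N$, $v$ majorizes $w$ if for each $k=1,\ldots,N$ the sum of the $k$ largest entries of $v$ is at least the sum of the $k$ largest entries of $w$, with equality when $k=N$. *)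

(* Defs.v *)
From HB Require Import structures.
From mathcomp Require Export all_boot all_order all_algebra.
From mathcomp Require Export all_classical all_reals all_analysis.
Set Implicit Arguments.
Unset Strict Implicit.
Unset Printing Implicit Defensive.
Import Order.TTheory GRing.Theory Num.Theory.
Local Open Scope classical_set_scope.
Local Open Scope ring_scope.

HB.instance Definition _ (n : nat) := isPointed.Build 'I_n.+1 ord0.

(* The finite state space {0, ..., n} carries the discrete sigma-algebra. *)
HB.instance Definition _ (n : nat) := @isMeasurable.Build
  default_measure_display 'I_n.+1 (@discrete_measurable 'I_n.+1)
  (@discrete_measurable0 'I_n.+1) (@discrete_measurableC 'I_n.+1)
  (@discrete_measurableU 'I_n.+1).

Definition stochastic (R : realType) (n : nat) (K : 'M[R]_n.+1) : Prop :=
  (forall i j, 0 <= K i j) /\ (forall i, \sum_j K i j = 1).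

Definition birth_and_death_kernel (R : realType) (n : nat) (K : 'M[R]_n.+1) :
    Prop :=
  stochastic K /\ forall i j : 'I_n.+1, (i.+1 < j)%N || (j.+1 < i)%N -> K i j = 0.

Definition symmetric_kernel (R : realType) (n : nat) (K : 'M[R]_n.+1) : Prop :=
  forall i j, K i j = K j i.

Definition uniform_kernel (R : realType) (n : nat) : 'M[R]_n.+1 :=
  \matrix_(i, j)
    if [|| i.+1 == j :> nat, j.+1 == i :> nat,
           (i == 0%N :> nat) && (j == 0%N :> nat) |
           (i == n :> nat) && (j == n :> nat)]
    then 2^-1 else 0.

(* The Markov property is stated multiplicatively, which avoids conditioning on
   null events. *)
Definition markov_chain (d : measure_display) (T : measurableType d)
    (R : realType) (P : probability T R) (n : nat) (K : 'M[R]_n.+1)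
    (X : nat -> {RV P >-> 'I_n.+1}) : Prop :=
  forall (t : nat) (x : nat -> 'I_n.+1),
    P [set w | forall s, (s <= t.+1)%N -> X s w = x s] =
    (P [set w | forall s, (s <= t)%N -> X s w = x s] *
      (K (x t) (x t.+1))%:E)%E.

Definition starts_at (d : measure_display) (T : measurableType d)
    (R : realType) (P : probability T R) (n : nat)
    (X : nat -> {RV P >-> 'I_n.+1}) (i : 'I_n.+1) : Prop :=
  P (X 0%N @^-1` [set i]) = 1%E.

Definition mass_function (d : measure_display) (T : measurableType d)
    (R : realType) (P : probability T R) (n : nat)
    (Y : {RV P >-> 'I_n.+1}) : 'rV[R]_n.+1 :=
  \row_i fine (P (Y @^-1` [set i])).

Definition sum_largest (R : realType) (N : nat) (k : nat) (v : 'rV[R]_N) : R :=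
  \sum_(a <- take k (sort (fun a b => b <= a) [seq v ord0 i | i <- enum 'I_N])) a.

Definition majorizes (R : realType) (N : nat) (v w : 'rV[R]_N) : Prop :=
  (forall k, (1 <= k <= N)%N -> sum_largest k w <= sum_largest k v) /\
  sum_largest N v = sum_largest N w.

(* Main.v *)
Require Import Defs.
From mathcomp Require Import all_boot all_order all_algebra.
From mathcomp Require Import all_classical all_reals all_analysis.
From mathcomp Require Import ring lra zify.
Import Order.TTheory GRing.Theory Num.Theory.
Local Open Scope ring_scope.

(** Let [H t k] be the mass that the law at time [t] of the chain with kernel
    [K] gives to the [k] states below [k], and let [p k] be the probability of
    crossing the edge joining [k-1] and [k].  Symmetry of [K] gives a closed
    recursion,
      [H (t+1) k = (1 - 2 p k) H t k + p k (H t (k-1) + H t (k+1))],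
    with [H 0 k = 1] for [k > 0] and with [H] frozen at [k = 0] and [k = n+1].
    For the uniform chain all [p k] equal 1/2; write [h] for its solution.
    It decreases in time, which through the recursion says that [h] is concave
    in [k]: the law of the uniform chain is nonincreasing and [h t k] is the sum
    of its [k] largest entries.  It remains to exhibit, for each [k], sets of
    [k] states on which the law of the other chain has mass at least [h t k].

    If all [p k <= 1/2], the recursion is monotone and [h <= H] follows at once.
    An edge with [p k > 1/2] is called fast; it has a negative coefficient
    [1 - 2 p k] in its recursion, and [h t k <= H t k] may fail there.  But two
    adjacent edges have [p k + p c <= 1], so the neighbours of a fast edge [c]
    have a positive coefficient [1 - 2 p k >= 2 p c - 1] that outweighs it.

    - Slow edges satisfy [h <= H] at all times ([cut_mass_le_slow]).  The
      contribution of a neighbour [c] to [H t k] obeys a two-step recursion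
      ([step_mass_pair]) in which the fast edge [c] has been eliminated and all
      coefficients are nonnegative with total 1.
    - At a fast edge [k], [h t k <= H t k] still holds when [t] and [k] have
      different parities ([cut_mass_le_parity]): over two steps the negative
      coefficient gets squared, and its effect on the two neighbours is again
      absorbed by their own laziness ([cut_mass_increment]).
    - When [t] and [k] have the same parity, [h t] is equal at [k] to the
      average of its own values at the two neighbours, because [h] changes
      at an edge only every other step ([cut_mass_half_parity]).  The
      neighbours are slow, so this average is at most that of [H t] at [k-1]
      and [k+1].  That average is in turn at most the larger of the masses of
      [{0,...,k-1}] and of [{0,...,k-2,k}], two sets of [k] states
      ([prefix_sum_avg_le_largest]). *)

(** * The mass on either side of an edge *)

Section CutMass.
Context {R : realType}.

(** In the recursion for the mass below an edge, the endpoints [k = 0] and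
    [k > n] are kept fixed by taking [p k = 0] there; the junk value [0.-1 = 0]
    is then harmless. *)
Fixpoint cut_mass (p : nat -> R) (t k : nat) : R :=
  if t is s.+1 then
    cut_mass p s k
    + p k * (cut_mass p s k.-1 + cut_mass p s k.+1 - 2 * cut_mass p s k)
  else (0 < k)%N%:R.

Definition half_rate (n k : nat) : R :=
  if (0 < k <= n)%N then 2^-1 else 0.

Implicit Types (p : nat -> R) (n t k c : nat).

Lemma cut_mass_const p t k : p k = 0 -> cut_mass p t k = (0 < k)%N%:R.
Proof. by move=> pk; elim: t => //= t ->; rewrite pk mul0r addr0. Qed.

Lemma cut_mass_half n t k : (0 < k <= n)%N ->
  2 * cut_mass (half_rate n) t.+1 k
  = cut_mass (half_rate n) t k.-1 + cut_mass (half_rate n) t k.+1.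
Proof. by move=> kn /=; rewrite /half_rate kn; lra. Qed.

Lemma cut_mass_half_out n t k : ~~ (0 < k <= n)%N ->
  cut_mass (half_rate n) t k = (0 < k)%N%:R.
Proof. by move=> kn; rewrite cut_mass_const// /half_rate (negbTE kn). Qed.

(** Through the recursion, this is concavity in [k], that is, monotonicity in
    space of the law of the uniform chain. *)
Lemma cut_mass_half_antitone n t k :
  cut_mass (half_rate n) t.+1 k <= cut_mass (half_rate n) t k.
Proof.
elim: t k => [|t IH] k; have [kn|kn] := boolP (0 < k <= n)%N;
  try by rewrite !cut_mass_half_out.
- have := cut_mass_half n 0 k kn; rewrite /=.
  by case: k kn => [|[|k]] //= _; lra.
- have := cut_mass_half n t.+1 k kn; have := cut_mass_half n t k kn.
  have := IH k.-1; have := IH k.+1; lra.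
Qed.

Lemma cut_mass_half_pred n t k :
  cut_mass (half_rate n) t k <= cut_mass (half_rate n) t.-1 k.
Proof. by case: t => //= t; exact: cut_mass_half_antitone. Qed.

Lemma cut_mass_half_le1 n t k : cut_mass (half_rate n) t k <= 1.
Proof.
elim: t => [|t IH]; first by rewrite /=; case: (0 < k)%N.
exact: le_trans (cut_mass_half_antitone n t k) IH.
Qed.

(** A simple random walk reaches [0] from [k] only at times of the parity of
    [k], and [1 - h t k] is the probability that it has done so by time [t]
    before meeting the other end. *)
Lemma cut_mass_half_parity n t k : odd t = odd k ->
  cut_mass (half_rate n) t.+1 k = cut_mass (half_rate n) t k.
Proof.
elim: t k => [|t IH] k tk; have [kn|kn] := boolP (0 < k <= n)%N;
  try by rewrite !cut_mass_half_out.
- have := cut_mass_half n 0 k kn; rewrite /=.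
  by case: k kn tk => [|[|k]] //= _ _; lra.
- have := cut_mass_half n t.+1 k kn; have := cut_mass_half n t k kn.
  by rewrite (IH k.-1) ?(IH k.+1); [lra|lia|lia].
Qed.

(** Twice the share of [H t k] that comes from the steps towards the neighbour
    [c]: the recursion of [H] at [k] is driven here by [c] alone. *)
Fixpoint step_mass (p : nat -> R) (k c t : nat) : R :=
  if t is s.+1 then (1 - 2 * p k) * step_mass p k c s + 2 * p k * cut_mass p s c
  else 1.

(** * Comparison with the uniform rates *)

Section Comparison.
Context (n : nat) (p : nat -> R).
Context (p_ge0 : forall k, 0 <= p k).
Context (p_sum : forall k, p k + p k.+1 <= 1).
Context (p_out : forall k, ~~ (0 < k <= n)%N -> p k = 0).

Notation H := (cut_mass p).
Notation h := (cut_mass (half_rate n)).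
Notation V := (step_mass p).

Lemma cut_mass_split k t : (0 < k)%N -> 2 * H t k = V k k.-1 t + V k k.+1 t.
Proof.
move=> k0; elim: t => [|t IH] /=; first by rewrite k0 mulr1.
have -> : V k k.-1 t = 2 * H t k - V k k.+1 t by rewrite IH; ring.
by ring.
Qed.

(** Eliminating [H t c] from two successive steps.  When [c] is fast and [k] is
    a neighbour, all coefficients are nonnegative, since
    [2 - 2 p k - 2 p c = (1 - 2 p k) - (2 p c - 1)]: the holding at [k] and the
    negative holding at [c] have been merged into one positive delay. *)
Lemma step_mass_pair k c t :
  V k c t.+2 = (2 - 2 * p k - 2 * p c) * V k c t.+1
             + (1 - 2 * p k) * (2 * p c - 1) * V k c t
             + 2 * p k * p c * (H t c.-1 + H t c.+1).
Proof. by rewrite /=; ring. Qed.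

Lemma rate_gt0 c : 2^-1 < p c -> (0 < c <= n)%N.
Proof. by move=> pc; apply: contraT => /p_out pc0; move: pc; rewrite pc0; lra. Qed.

Lemma rate_pred c : p c.-1 + p c <= 1.
Proof. by case: c => [|c]; [rewrite p_out//=; lra|exact: p_sum]. Qed.

(** The two-step recursion calls for two consecutive bounds in the induction;
    at [s = 0] the first of them reads [h 0 c <= 1], as [0.-1 = 0]. *)
Lemma step_mass_ge k c T : p k <= 2^-1 -> p k + p c <= 1 ->
  (forall s b, (s <= T)%N -> p b <= 2^-1 -> h s b <= H s b) ->
  forall s, (s <= T)%N -> h s.-1 c <= V k c s /\ h s c <= V k c s.+1.
Proof.
move=> pk pkc hH; have p0 := p_ge0 k.
have h1 := cut_mass_half_le1 n 0 c.
have V1 : h 0 c <= V k c 1.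
  have -> : V k c 1 = (1 - 2 * p k) + 2 * p k * h 0 c by rewrite /= mulr1.
  have : 0 <= (1 - 2 * p k) * (1 - h 0 c) by apply: mulr_ge0; lra.
  lra.
elim=> [|s IH] sT; first by split.
have [IH1 IH2] := IH (ltnW sT); split => //.
have hs1 := cut_mass_half_antitone n s c.
have [pc|pc] := lerP (p c) 2^-1.
  have Hc := hH _ _ sT pc.
  have -> : V k c s.+2 = (1 - 2 * p k) * V k c s.+1 + 2 * p k * H s.+1 c by [].
  have e1 : (1 - 2 * p k) * h s.+1 c <= (1 - 2 * p k) * V k c s.+1.
    by apply: ler_wpM2l; lra.
  have e2 : 2 * p k * h s.+1 c <= 2 * p k * H s.+1 c by apply: ler_wpM2l; lra.
  lra.
have cn := rate_gt0 c pc.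
have [pc1 pc2] : p c.-1 <= 2^-1 /\ p c.+1 <= 2^-1.
  by have := rate_pred c; have := p_sum c; lra.
have Hl := hH _ _ (ltnW sT) pc1; have Hr := hH _ _ (ltnW sT) pc2.
have hs := cut_mass_half n s c cn; have hp := cut_mass_half_pred n s c.
rewrite step_mass_pair.
have e1 : (2 - 2 * p k - 2 * p c) * h s.+1 c
    <= (2 - 2 * p k - 2 * p c) * V k c s.+1 by apply: ler_wpM2l; lra.
have e2 : (1 - 2 * p k) * (2 * p c - 1) * h s.+1 c
    <= (1 - 2 * p k) * (2 * p c - 1) * V k c s.
  by apply: ler_wpM2l; [apply: mulr_ge0; lra | lra].
have e3 : 2 * p k * p c * (2 * h s.+1 c)
    <= 2 * p k * p c * (H s c.-1 + H s c.+1).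
  by apply: ler_wpM2l; [rewrite !mulr_ge0// ; lra | lra].
lra.
Qed.

(** Averaging [step_mass_ge] over the two neighbours turns [h t] into
    [h (t+1) k].  Only slow edges at earlier times enter, because the fast
    neighbours of [k] have slow neighbours themselves. *)
Lemma cut_mass_le_slow t k : p k <= 2^-1 -> h t k <= H t k.
Proof.
elim/ltn_ind: t k => -[|t] // IH k pk.
have [kn|kn] := boolP (0 < k <= n)%N; last first.
  by rewrite cut_mass_half_out// cut_mass_const// p_out.
have /andP[k0 _] := kn.
have IH' s b : (s <= t)%N -> p b <= 2^-1 -> h s b <= H s b.
  by move=> st; exact: (IH s st).
have [_ hl] : h t.-1 k.-1 <= V k k.-1 t /\ h t k.-1 <= V k k.-1 t.+1.
  by apply: (@step_mass_ge k k.-1 t); rewrite 1?addrC ?rate_pred.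
have [_ hr] : h t.-1 k.+1 <= V k k.+1 t /\ h t k.+1 <= V k k.+1 t.+1.
  by apply: (@step_mass_ge k k.+1 t).
have := cut_mass_split k t.+1 k0; have := cut_mass_half n t k kn.
lra.
Qed.

(** The laziness [1 - 2 p k] of an edge next to a fast edge [c] is at least
    [2 p c - 1], so subtracting [(2 p c - 1) H t k] leaves nonnegative
    coefficients. *)
Lemma cut_mass_increment t k c : p k + p c <= 1 -> 2^-1 < p c ->
  h t k <= H t k -> h t k.-1 <= H t k.-1 -> h t k.+1 <= H t k.+1 ->
  (2 - 2 * p c) * h t.+1 k <= H t.+1 k - (2 * p c - 1) * H t k.
Proof.
move=> pkc pc Hk Hl Hr; have p0 := p_ge0 k.
have [kn|kn] := boolP (0 < k <= n)%N; last first.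
  rewrite !cut_mass_half_out// !cut_mass_const ?(p_out k)//; lra.
have hs := cut_mass_half n t k kn; have hm := cut_mass_half_antitone n t k.
rewrite [H t.+1 k]/=.
have e1 : (2 - 2 * p k - 2 * p c) * h t.+1 k
    <= (2 - 2 * p k - 2 * p c) * H t k by apply: ler_wpM2l; lra.
have e2 : p k * (2 * h t.+1 k) <= p k * (H t k.-1 + H t k.+1).
  by apply: ler_wpM2l; lra.
lra.
Qed.

(** With [b := 2 p k - 1] at a fast edge, two steps of the recursion give
    [H (t+2) k = b^2 H t k + p k ((H (t+1) - b H t) (k-1)
                                  + (H (t+1) - b H t) (k+1))],
    and each summand is bounded below by [cut_mass_increment].  The bounds used
    at time [t] concern edges at distance 0, 1 and 2 of [k]: those at distance
    1 are slow, the others have the parity of [k]. *)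
Lemma cut_mass_le_parity t k : odd t != odd k -> h t k <= H t k.
Proof.
elim/ltn_ind: t k => -[|[|t]] // IH k tk.
  have [kn|kn] := boolP (0 < k <= n)%N; last first.
    by rewrite cut_mass_half_out// cut_mass_const// p_out.
  (* Here [k] is even, hence at least 2, and [H 1 k = 1]. *)
  by move: (cut_mass_half_le1 n 1 k); case: k tk kn => [|[|k]] //= _ _; lra.
have [pk|pk] := lerP (p k) 2^-1; first exact: cut_mass_le_slow.
have kn := rate_gt0 k pk.
have [pk1 pk2] := (rate_pred k, p_sum k).
have IHt b : odd t != odd b -> h t b <= H t b by exact: IH.
have tk' : odd t != odd k by move: tk; rewrite /= negbK.
have [k0 kk] : (0 < k)%N /\ k = k.-1.+1 by lia.
have el : (2 - 2 * p k) * h t.+1 k.-1 <= H t.+1 k.-1 - (2 * p k - 1) * H t k.-1.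
  apply: cut_mass_increment => //; first by apply: cut_mass_le_slow; lra.
    have [->|k1] := eqVneq k.-1 0%N; last by apply: IHt; lia.
    by rewrite cut_mass_half_out// cut_mass_const// p_out.
  by rewrite -kk; exact: IHt.
have er : (2 - 2 * p k) * h t.+1 k.+1 <= H t.+1 k.+1 - (2 * p k - 1) * H t k.+1.
  apply: cut_mass_increment => //; [lra| |exact: IHt|by apply: IHt; rewrite /= negbK].
  by apply: cut_mass_le_slow; lra.
have hs := cut_mass_half n t.+1 k kn.
have hm : h t.+2 k <= H t k.
  by apply: le_trans (IHt _ tk'); do 2 (apply: le_trans (cut_mass_half_antitone _ _ _) _).
have -> : H t.+2 k = (2 * p k - 1) ^+ 2 * H t k
    + p k * (H t.+1 k.-1 - (2 * p k - 1) * H t k.-1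
             + (H t.+1 k.+1 - (2 * p k - 1) * H t k.+1)).
  by rewrite /=; ring.
have e1 := ler_wpM2l (sqr_ge0 (2 * p k - 1)) hm.
have e2 := ler_wpM2l (p_ge0 k) (lerD el er).
have e3 : (2 - 2 * p k) * h t.+1 k.-1 + (2 - 2 * p k) * h t.+1 k.+1
  = (2 - 2 * p k) * (2 * h t.+2 k) by rewrite hs; ring.
rewrite e3 in e2; lra.
Qed.

(** The remaining case, a fast edge whose parity is that of [t]: both neighbours
    are slow, and there [h] takes the same values at the previous time. *)
Lemma cut_mass_le_or t k :
  h t k <= H t k \/ (0 < k <= n)%N /\ 2 * h t k <= H t k.-1 + H t k.+1.
Proof.
have [tk|tk] := eqVneq (odd t) (odd k); last by left; exact: cut_mass_le_parity.
have [pk|pk] := lerP (p k) 2^-1; first by left; exact: cut_mass_le_slow.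
have kn := rate_gt0 k pk.
case: t tk => [|t] tk; first by left.
right; split=> //; rewrite cut_mass_half//.
have [pk1 pk2] := (rate_pred k, p_sum k).
rewrite -(cut_mass_half_parity n t k.-1) -?(cut_mass_half_parity n t k.+1); [|lia|lia].
by apply: lerD; apply: cut_mass_le_slow; lra.
Qed.

End Comparison.
End CutMass.

(** * Sums of largest entries *)

Section Largest.
Context {R : realType}.

Lemma sum_subseq_le_take (u s : seq R) :
  subseq u s -> sorted (fun a b => b <= a) s ->
  \sum_(a <- u) a <= \sum_(a <- take (size u) s) a.
Proof.
elim: s u => [|y s IH] [|x u] //= us ss.
rewrite !big_cons.
have geT : transitive (fun a b : R => b <= a) by move=> a b c ab /le_trans; apply.
have xy : x <= y.
  have : x \in y :: s by apply: (@mem_subseq _ (x :: u)); [exact: us | rewrite inE eqxx].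
  rewrite inE => /orP[/eqP->//|].
  by move: (order_path_min geT ss) => /allP; apply.
apply: lerD => //; apply: IH; last exact: path_sorted ss.
by move: us; case: eqP => // _ /(subseq_trans (subseq_cons _ _)).
Qed.

(** Sorting the indices rather than the values makes the entries over [A] a
    subsequence of the sorted vector. *)
Lemma sum_le_sum_largest N (v : 'rV[R]_N) (A : {set 'I_N}) :
  \sum_(i in A) v ord0 i <= sum_largest #|A| v.
Proof.
rewrite /sum_largest sort_map.
set e := sort _ _; have ee : perm_eq e (enum 'I_N) by rewrite perm_sort.
set u := [seq v ord0 i | i <- e & i \in A].
have -> : \sum_(i in A) v ord0 i = \sum_(a <- u) a.
  by rewrite big_map big_filter (perm_big _ ee) big_enum_cond.
have -> : #|A| = size u.
  rewrite size_map size_filter (permP ee) cardE -size_filter /enum_mem.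
  by congr size; rewrite -filter_predI; apply: eq_filter => i /=; rewrite andbT.
apply: sum_subseq_le_take; first by apply: map_subseq; apply: filter_subseq.
rewrite /e -sort_map; apply: sort_sorted => a b; exact: le_total.
Qed.

Definition prefix_sum {n} (v : 'rV[R]_n.+1) k := \sum_(j < k) v ord0 (inord j).

Lemma prefix_sumS n (v : 'rV[R]_n.+1) k :
  prefix_sum v k.+1 = prefix_sum v k + v ord0 (inord k).
Proof. by rewrite /prefix_sum big_ord_recr. Qed.

Lemma prefix_sumE n (v : 'rV[R]_n.+1) k : (k <= n.+1)%N ->
  prefix_sum v k = \sum_(i < n.+1 | (i < k)%N) v ord0 i.
Proof.
move=> kn; rewrite /prefix_sum (big_ord_widen _ (fun j => v ord0 (inord j)) kn).
by apply: eq_bigr => i _; rewrite inord_val.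
Qed.

Lemma card_ord_lt n k : (k <= n)%N -> #|[set i : 'I_n | (i < k)%N]| = k.
Proof.
move=> kn; rewrite cardsE -sum1_card.
by rewrite -(big_ord_widen n (fun=> 1%N) kn) sum1_card card_ord.
Qed.

Lemma prefix_sum_le_largest n (v : 'rV[R]_n.+1) k : (k <= n.+1)%N ->
  prefix_sum v k <= sum_largest k v.
Proof.
move=> kn; rewrite prefix_sumE//.
have := sum_le_sum_largest _ v [set i : 'I_n.+1 | (i < k)%N].
by rewrite card_ord_lt// (eq_bigl (fun i : 'I_n.+1 => (i < k)%N)) // => i; rewrite inE.
Qed.

(** The left-hand side is the mass of [{0,...,k-1}] plus that of
    [{0,...,k-2,k}]. *)
Lemma prefix_sum_avg_le_largest n (v : 'rV[R]_n.+1) k : (0 < k <= n)%N ->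
  prefix_sum v k.-1 + prefix_sum v k.+1 <= 2 * sum_largest k v.
Proof.
case: k => //= k kn; rewrite prefix_sumS.
have h1 := prefix_sum_le_largest n v k.+1 (ltnW kn).
pose A := inord k.+1 |: [set i : 'I_n.+1 | (i < k)%N].
have kA : inord k.+1 \notin [set i : 'I_n.+1 | (i < k)%N].
  by rewrite inE inordK// -leqNgt.
have := sum_le_sum_largest _ v A.
rewrite cardsU1 kA card_ord_lt ?add1n; last by lia.
rewrite big_setU1//= (eq_bigl (fun i : 'I_n.+1 => (i < k)%N)); last first.
  by move=> i; rewrite inE.
rewrite -prefix_sumE; last by lia.
lra.
Qed.

Lemma sum_largest_nonincreasing n (v : 'rV[R]_n.+1) k : (k <= n.+1)%N ->
  (forall j, (j < n)%N -> v ord0 (inord j.+1) <= v ord0 (inord j)) ->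
  sum_largest k v = prefix_sum v k.
Proof.
move=> kn vd; pose f j := v ord0 (inord j).
have -> : sum_largest k v = \sum_(a <- take k [seq f j | j <- iota 0 n.+1]) a.
  rewrite /sum_largest -val_enum_ord -map_comp.
  rewrite (@eq_map _ _ (f \o val) (v ord0)); last first.
    by move=> i; rewrite /f /= inord_val.
  rewrite sorted_sort//; first by move=> a b c ab /le_trans; apply.
  rewrite -(@eq_map _ _ (f \o val) (v ord0)); last first.
    by move=> i; rewrite /f /= inord_val.
  rewrite map_comp val_enum_ord; apply/(sortedP 0) => i.
  rewrite size_map size_iota => ii; rewrite !(nth_map 0%N) ?size_iota ?nth_iota; try lia.
  by rewrite !add0n; exact: vd.
rewrite -map_take take_iota (minn_idPl kn) big_map /prefix_sum.
by rewrite -(big_mkord xpredT f) /index_iota subn0.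
Qed.
End Largest.

(** * From kernels to rates *)

Section Kernel.
Context {R : realType} {n : nat}.
Implicit Type K : 'M[R]_n.+1.

Definition edge_rate (K : 'M[R]_n.+1) k : R :=
  if (0 < k <= n)%N then K (inord k.-1) (inord k) else 0.

Lemma edge_rate_out K k : ~~ (0 < k <= n)%N -> edge_rate K k = 0.
Proof. by rewrite /edge_rate => /negbTE->. Qed.

Lemma kernel_le1 K i j : stochastic K -> K i j <= 1.
Proof.
by case=> K0 /(_ i) <-; rewrite (bigD1 j)//= lerDl sumr_ge0.
Qed.

Lemma edge_rate_ge0 K k : stochastic K -> 0 <= edge_rate K k.
Proof. by case=> K0 _; rewrite /edge_rate; case: ifP. Qed.

Lemma edge_rate_add_le1 K k : stochastic K -> symmetric_kernel K ->
  edge_rate K k + edge_rate K k.+1 <= 1.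
Proof.
move=> sK symK; rewrite /edge_rate.
case: ifPn => k1; case: ifPn => k2; rewrite ?addr0 ?add0r ?kernel_le1 ?ler01//.
have [K0 <-] := (sK.1, sK.2 (inord k)).
have jk : inord k.-1 != inord k.+1 :> 'I_n.+1.
  by apply/negP => /eqP/(congr1 (@nat_of_ord _)); rewrite !inordK; lia.
rewrite (bigD1 (inord k.-1))//= (bigD1 (inord k.+1))/=; last by rewrite eq_sym.
by rewrite addrA symK lerDl sumr_ge0.
Qed.

(** From [i], a nearest-neighbour chain can change sides of the edge joining
    [k-1] and [k] only if [i] is one of its ends. *)
Lemma row_prefix_sum K (i : 'I_n.+1) k : birth_and_death_kernel K ->
  symmetric_kernel K -> (k <= n.+1)%N ->
  \sum_(j < n.+1 | (j < k)%N) K i j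
  = (i < k)%N%:R + edge_rate K k * ((i == k :> nat)%:R - (i.+1 == k)%:R).
Proof.
move=> [[K0 K1] Kbd] symK kn.
have [->|k0] := posnP k.
  by rewrite edge_rate_out// big_pred0 ?mul0r ?addr0.
have [ik|ki] := ltnP i k.
  have -> : (i == k :> nat) = false by lia.
  have -> : \sum_(j < n.+1 | (j < k)%N) K i j
      = 1 - \sum_(j < n.+1 | ~~ (j < k)%N) K i j.
    rewrite -(K1 i) [in RHS](bigID (fun j : 'I_n.+1 => (j < k)%N))/=.
    by rewrite addrK.
  have [ik1|ik1] := eqVneq i.+1 k; last first.
    rewrite big1; first by rewrite mulr0n subrr mulr0 addr0 subr0.
    by move=> j; rewrite -leqNgt => kj; apply: Kbd; lia.
  rewrite sub0r mulrN1; congr (_ - _); rewrite /edge_rate.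
  case: ifPn => [kr|kr]; last by rewrite big_pred0// => j; have := ltn_ord j; lia.
  rewrite (bigD1 (inord k))/=; last by rewrite inordK; lia.
  rewrite big1 ?addr0.
    by congr (K _ _); apply: val_inj; rewrite /= inordK; lia.
  move=> j /andP[jk /eqP jk']; apply: Kbd.
  have : j <> k :> nat by move=> e; apply: jk'; rewrite -e inord_val.
  lia.
have -> : (i.+1 == k) = false by lia.
rewrite subr0 add0r; have [ik|ik] := eqVneq (i : nat) k; last first.
  by rewrite big1 ?mulr0// => j jk; apply: Kbd; lia.
have kr : (0 < k <= n)%N by have := ltn_ord i; lia.
rewrite mulr1 /edge_rate kr (bigD1 (inord k.-1))/=; last by rewrite inordK; lia.
rewrite big1 ?addr0.
  by rewrite symK; congr (K _ _); apply: val_inj; rewrite /= inordK; lia.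
move=> j /andP[jk /eqP jk']; apply: Kbd.
have : j <> k.-1 :> nat by move=> e; apply: jk'; rewrite -e inord_val.
lia.
Qed.

Lemma prefix_sum_step K (v w : 'rV[R]_n.+1) k : birth_and_death_kernel K ->
  symmetric_kernel K -> w = v *m K -> (k <= n.+1)%N ->
  prefix_sum w k = prefix_sum v k
   + edge_rate K k * (prefix_sum v k.-1 + prefix_sum v k.+1 - 2 * prefix_sum v k).
Proof.
move=> Kbd symK -> kn; rewrite [LHS]prefix_sumE//.
have -> : \sum_(j < n.+1 | (j < k)%N) (v *m K) ord0 j
    = \sum_i v ord0 i * \sum_(j < n.+1 | (j < k)%N) K i j.
  under eq_bigr do rewrite mxE; rewrite exchange_big/=.
  by apply: eq_bigr => i _; rewrite mulr_sumr.
under eq_bigr do rewrite row_prefix_sum// mulrDr.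
rewrite big_split/=; congr (_ + _).
  rewrite prefix_sumE// [RHS]big_mkcond/=; apply: eq_bigr => i _.
  by case: ifP; rewrite ?mulr1 ?mulr0.
have [kr|/edge_rate_out kr] := boolP (0 < k <= n)%N; last first.
  by rewrite kr mul0r big1// => i _; rewrite mul0r mulr0.
have -> : prefix_sum v k.-1 + prefix_sum v k.+1 - 2 * prefix_sum v k
    = v ord0 (inord k) - v ord0 (inord k.-1).
  by case: k kr {kn} => //= k _; rewrite !prefix_sumS; ring.
rewrite (bigD1 (inord k))//= (bigD1 (inord k.-1))/=; last first.
  by apply/negP => /eqP/(congr1 (@nat_of_ord _)); rewrite !inordK; lia.
rewrite big1 ?addr0; last first.
  move=> i /andP[/eqP ik /eqP ik1].
  have e1 : i <> k :> nat by move=> e; apply: ik; rewrite -e inord_val.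
  have e2 : i <> k.-1 :> nat by move=> e; apply: ik1; rewrite -e inord_val.
  have -> : (i == k :> nat) = false by lia.
  have -> : (i.+1 == k) = false by lia.
  by rewrite subrr !mulr0.
rewrite !inordK; [|lia|lia].
have -> : (k.+1 == k) = false by lia.
have -> : (k.-1 == k) = false by lia.
have -> : (k.-1.+1 == k) = true by lia.
by rewrite eqxx mulr1n mulr0n; ring.
Qed.

(** The uniform chain moves to [min (i+1) n] or to [max (i-1) 0] with
    probability 1/2 each; this form makes its row sums immediate. *)
Lemma uniform_kernelE (i j : 'I_n.+1) : (0 < n)%N ->
  uniform_kernel R n i j
  = 2^-1 * (j == inord (minn i.+1 n))%:R + 2^-1 * (j == inord i.-1)%:R.
Proof.
move=> n0; rewrite mxE.
have inordE m : (m <= n)%N -> (j == inord m) = (j == m :> nat).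
  by move=> mn; rewrite -val_eqE /= inordK.
have [hi hj] := (ltn_ord i, ltn_ord j).
rewrite !inordE; [|lia|lia].
case: ifPn => ij.
  have [e|e] := eqVneq (j : nat) (minn i.+1 n).
    have -> : (j == i.-1 :> nat) = false by lia.
    by rewrite mulr1 mulr0 addr0.
  have -> : (j == i.-1 :> nat) = true by lia.
  by rewrite mulr1 mulr0 add0r.
have -> : (j == i.-1 :> nat) = false by lia.
have -> : (j == minn i.+1 n :> nat) = false by lia.
by rewrite mulr0 addr0.
Qed.

Lemma uniform_kernel_birth_death : (0 < n)%N ->
  birth_and_death_kernel (uniform_kernel R n).
Proof.
move=> n0; split; [split|] => [i j|i|i j ij].
- by rewrite mxE; case: ifP => // _; rewrite invr_ge0.
- under eq_bigr do rewrite uniform_kernelE//.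
  have sum1 (m : 'I_n.+1) : \sum_j 2^-1 * (j == m)%:R = 2^-1 :> R.
    rewrite (bigD1 m)//= eqxx mulr1 big1 ?addr0// => j /negbTE->.
    by rewrite mulr0.
  by rewrite big_split/= !sum1; lra.
- by rewrite mxE ifF//; have [hi hj] := (ltn_ord i, ltn_ord j); lia.
Qed.

Lemma uniform_kernel_symmetric : symmetric_kernel (uniform_kernel R n).
Proof.
move=> i j; rewrite !mxE; congr (if _ then _ else _).
by rewrite [(i.+1 == j) || _]orbCA (andbC (i == 0%N :> nat)) (andbC (i == n :> nat)).
Qed.

Lemma edge_rate_uniform : edge_rate (uniform_kernel R n) = half_rate n.
Proof.
apply/funext => k; rewrite /edge_rate /half_rate; case: ifPn => // kn.
by rewrite mxE !inordK; [rewrite ifT//; lia|lia|lia].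
Qed.

Definition law_evolution (K : 'M[R]_n.+1) (mu : nat -> 'rV[R]_n.+1) :=
  mu 0%N = delta_mx ord0 ord0 /\ forall t, mu t.+1 = mu t *m K.

Lemma prefix_sum_law K mu t k : birth_and_death_kernel K -> symmetric_kernel K ->
  law_evolution K mu -> (k <= n.+1)%N ->
  prefix_sum (mu t) k = cut_mass (edge_rate K) t k.
Proof.
move=> Kbd symK [mu0 muS]; elim: t k => [|t IH] k kn.
  rewrite prefix_sumE// mu0 /=; case: k kn => [|k] kn; first by rewrite big_pred0.
  rewrite (bigD1 ord0)//= big1 ?addr0; first by rewrite mxE !eqxx.
  by move=> i /andP[_ /negbTE i0]; rewrite mxE i0 andbF.
rewrite (prefix_sum_step _ _ _ _ Kbd symK (muS t))// /= IH//.
have [kr|/edge_rate_out->] := boolP (0 < k <= n)%N; last by rewrite !mul0r.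
by rewrite !IH//; lia.
Qed.

(** Monotonicity in time of [h] is monotonicity in space of its increments, so
    the law of the uniform chain is already sorted. *)
Lemma uniform_law_largest mu t k : (0 < n)%N ->
  law_evolution (uniform_kernel R n) mu -> (k <= n.+1)%N ->
  sum_largest k (mu t) = cut_mass (half_rate n) t k.
Proof.
move=> n0 muU kn.
have pE j : (j <= n.+1)%N -> prefix_sum (mu t) j = cut_mass (half_rate n) t j.
  move=> jn; rewrite -edge_rate_uniform; apply: prefix_sum_law => //.
  - exact: uniform_kernel_birth_death.
  - exact: uniform_kernel_symmetric.
rewrite -pE//; apply: sum_largest_nonincreasing => // j jn.
have jr : (0 < j.+1 <= n)%N by lia.
have := cut_mass_half (R := R) n t j.+1 jr.
have := cut_mass_half_antitone (R := R) n t j.+1.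
rewrite -!pE; [|lia..]; rewrite [j.+1.-1]/= !prefix_sumS; lra.
Qed.

Lemma sum_largest_all (v : 'rV[R]_n.+1) : sum_largest n.+1 v = prefix_sum v n.+1.
Proof.
rewrite /sum_largest take_oversize; last by rewrite size_sort size_map size_enum_ord.
rewrite (perm_big [seq v ord0 i | i <- enum 'I_n.+1])/=; last by rewrite perm_sort.
rewrite big_map big_enum prefix_sumE//; apply: eq_bigl => i.
by rewrite ltn_ord.
Qed.

Lemma majorizes_uniform K mu nu t : (0 < n)%N -> birth_and_death_kernel K ->
  symmetric_kernel K -> law_evolution K mu ->
  law_evolution (uniform_kernel R n) nu -> majorizes (mu t) (nu t).
Proof.
move=> n0 Kbd symK muK nuU; have sK := Kbd.1.
have pE j : (j <= n.+1)%N -> prefix_sum (mu t) j = cut_mass (edge_rate K) t j.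
  exact: prefix_sum_law.
split=> [k /andP[_ kn]|].
  rewrite (uniform_law_largest nu)//.
  have [||j|hH|[kr hH]] := cut_mass_le_or n (edge_rate K) _ _ _ t k.
  - by move=> j; exact: edge_rate_ge0.
  - by move=> j; exact: edge_rate_add_le1.
  - exact: edge_rate_out.
  - by apply: le_trans hH _; rewrite -pE//; exact: prefix_sum_le_largest.
  have := prefix_sum_avg_le_largest _ (mu t) k kr; rewrite !pE; [|lia..].
  by move: hH; lra.
rewrite (uniform_law_largest nu)// sum_largest_all pE//.
by rewrite !cut_mass_const// ?edge_rate_out ?/half_rate ?ltnn ?andbF.
Qed.
End Kernel.

(** * Laws of Markov chains *)

Section Law.
Local Open Scope classical_set_scope.
Local Open Scope ring_scope.
Context {d : measure_display} {T : measurableType d} {R : realType}.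
Context (P : probability T R).

Lemma measure_finite_partition {F : finType} (g : T -> F) (E : set T) :
  measurable E -> (forall f, measurable (g @^-1` [set f])) ->
  P E = (\sum_f P (E `&` g @^-1` [set f]))%E.
Proof.
move=> mE mg.
have {1}-> : E = \bigcup_(f in [set: F]) (E `&` g @^-1` [set f]).
  by apply/seteqP; split=> [w Ew|w [f _ []]//]; exists (g w).
rewrite measure_fin_bigcup//=.
- have -> : [set: F] = [set` enum F].
    by apply/seteqP; split=> f //= _; rewrite mem_enum.
  by rewrite -fsbig_seq ?enum_uniq// big_enum.
- by move=> f f' _ _ [w [[_ <-] [_ <-]]].
- by move=> f _; exact: measurableI.
Qed.

Context (n : nat) (X : nat -> {RV P >-> 'I_n.+1}).

Lemma measurable_state t i : measurable (X t @^-1` [set i]).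
Proof.
have -> : X t @^-1` [set i] = setT `&` X t @^-1` [set i] by rewrite setTI.
exact: measurable_funP.
Qed.

Lemma mass_functionE t i : (mass_function (X t) ord0 i)%:E = P (X t @^-1` [set i]).
Proof. by rewrite mxE fineK// fin_num_measure//; exact: measurable_state. Qed.

Lemma mass_function_start : starts_at X ord0 ->
  mass_function (X 0%N) = delta_mx ord0 ord0.
Proof.
move=> X0; apply/rowP => i; rewrite [RHS]mxE eqxx/=; apply: EFin_inj.
rewrite mass_functionE; have [->|i0] := eqVneq i ord0; first exact: X0.
suff: P (X 0%N @^-1` [set i]) = 0%E by move=> ->.
apply/eqP; rewrite eq_le measure_ge0 andbT.
have <- : P (~` (X 0%N @^-1` [set ord0])) = 0%E.
  by rewrite probability_setC ?X0 ?subee//; exact: measurable_state.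
apply: le_measure; rewrite ?inE; [exact: measurable_state| |].
  by apply: measurableC; exact: measurable_state.
by move=> w /= ->; exact/eqP.
Qed.

Definition path_map t (w : T) : {ffun 'I_t.+1 -> 'I_n.+1} :=
  [ffun s : 'I_t.+1 => X s w].

Lemma path_mapP t (f : {ffun 'I_t.+1 -> 'I_n.+1}) :
  path_map t @^-1` [set f]
  = [set w | forall s, (s <= t)%N -> X s w = f (inord s)].
Proof.
apply/seteqP; split=> [w <- s st|w wf]; first by rewrite ffunE inordK.
by apply/ffunP => s; rewrite ffunE wf ?inord_val// -ltnS.
Qed.

Lemma measurable_path t f : measurable (path_map t @^-1` [set f]).
Proof.
have -> : path_map t @^-1` [set f]
    = \bigcap_(s in [set: 'I_t.+1]) (X s @^-1` [set f s]).
  apply/seteqP; split=> [w <- s _|w wf]; first by rewrite /= ffunE.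
  by apply/ffunP => s; rewrite ffunE; exact: wf.
by apply: fin_bigcap_measurable => // s _; exact: measurable_state.
Qed.

(** The Markov property speaks of whole trajectories: both sides are expanded
    over the trajectories up to time [t]. *)
Lemma mass_function_step (K : 'M[R]_n.+1) t : markov_chain K X ->
  mass_function (X t.+1) = mass_function (X t) *m K.
Proof.
move=> markovX; pose q (f : {ffun 'I_t.+1 -> 'I_n.+1}) :=
  fine (P (path_map t @^-1` [set f])).
have qE f : P (path_map t @^-1` [set f]) = (q f)%:E.
  by rewrite fineK// fin_num_measure//; exact: measurable_path.
have now i : mass_function (X t) ord0 i
    = \sum_(f : {ffun 'I_t.+1 -> 'I_n.+1} | f ord_max == i) q f.
  apply: EFin_inj; rewrite mass_functionE -sumEFin [RHS]big_mkcond/=.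
  rewrite (measure_finite_partition (path_map t) _ (measurable_state _ _)
    (measurable_path t)).
  apply: eq_bigr => f _; case: eqP => [fi|fi].
    rewrite -qE; congr (P _); apply/seteqP; split=> [w []//|w wf]; split => //=.
    by rewrite -fi -wf ffunE.
  rewrite (_ : _ `&` _ = set0) ?measure0//.
  by apply/seteqP; split=> // w [/= wi wf]; apply: fi; rewrite -wi -wf ffunE.
apply/rowP => j; rewrite [RHS]mxE.
under [RHS]eq_bigr do rewrite now mulr_suml.
have -> : \sum_i \sum_(f : {ffun 'I_t.+1 -> 'I_n.+1} | f ord_max == i) q f * K i j
    = \sum_(f : {ffun 'I_t.+1 -> 'I_n.+1}) q f * K (f ord_max) j.
  rewrite [RHS](partition_big (fun f : {ffun 'I_t.+1 -> 'I_n.+1} => f ord_max) xpredT)//=.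
  by apply: eq_bigr => i _; apply: eq_bigr => f /eqP->.
apply: EFin_inj; rewrite mass_functionE -sumEFin.
rewrite (measure_finite_partition (path_map t) _ (measurable_state _ _)
    (measurable_path t)).
apply: eq_bigr => f _; rewrite EFinM -qE path_mapP.
(* The trajectory [f] up to time [t], continued by [j]. *)
have := markovX t (fun s => if (s <= t)%N then f (inord s) else j).
rewrite leqnn ltnn (_ : inord t = ord_max); last first.
  by apply: val_inj; rewrite /= inordK.
move=> markovXt; transitivity (P [set w | forall s, (s <= t)%N ->
    X s w = (if (s <= t)%N then f (inord s) else j)] * (K (f ord_max) j)%:E)%E.
  rewrite -markovXt; congr (P _); apply/seteqP; split.
    move=> w [/= wj wf] s; rewrite leq_eqVlt => /predU1P[->|st].
      by rewrite ltnn.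
    by rewrite -ltnS st; apply: wf.
  move=> w /= wx; split; first by rewrite wx// ltnn.
  by move=> s st; rewrite wx ?st// leqW.
congr (P _ * _)%E; apply/seteqP; split=> w /= wx s st; have := wx s st;
  by rewrite st.
Qed.

Lemma law_evolution_mass_function (K : 'M[R]_n.+1) :
  markov_chain K X -> starts_at X ord0 ->
  law_evolution K (fun t => mass_function (X t)).
Proof.
move=> markovX X0; split; first exact: mass_function_start.
by move=> t; exact: mass_function_step.
Qed.
End Law.

Theorem theorem4p3 (R : realType) (n : nat) (n_gt0 : (0 < n)%N)
    (d : measure_display) (T : measurableType d) (P : probability T R)
    (K : 'M[R]_n.+1) (X : nat -> {RV P >-> 'I_n.+1})
    (d' : measure_display) (T' : measurableType d') (Q : probability T' R)
    (U : nat -> {RV Q >-> 'I_n.+1}) :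
  birth_and_death_kernel K -> symmetric_kernel K ->
  markov_chain K X -> starts_at X ord0 ->
  markov_chain (uniform_kernel R n) U -> starts_at U ord0 ->
  forall t : nat, majorizes (mass_function (X t)) (mass_function (U t)).
Proof.
move=> Kbd symK markovX X0 markovU U0 t.
exact: (majorizes_uniform K _ _ t n_gt0 Kbd symK
  (law_evolution_mass_function P n X K markovX X0)
  (law_evolution_mass_function Q n U _ markovU U0)).
Qed.
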